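(* Let $G$ be a finite group and let $L, H \in \mathcal{CD}(G)$ with $L < H$ be such that the interval $\llbracket L, H \rrbracket$ in $\mathcal{CD}(G)$ is a quasi-antichain of width $w \geq 3$. Then there exist a prime $p$ and positive integers $a, b$ with $b \leq a$ such that $H/L$ and $C_G(L)/C_G(H)$ are elementary abelian $p$-groups of order $p^{2a}$ and $w = p^b + 1$.
   Context: For a finite group $G$ and a subgroup $U \leq G$, the Chermak-Delgado measure of $U$ in $G$ is $m_G(U) = |U|\,|C_G(U)|$. Let $m^*(G)$ be the maximum of $m_G(U)$ over all subgroups $U \leq G$. The Chermak-Delgado lattice of $G$ is $\mathcal{CD}(G) = \{U \leq G : m_G(U) = m^*(G)\}$, ordered by inclusion (it is a sublattice of the subgroup lattice of $G$). For $L, H \in \mathcal{CD}(G)$ with $L \leq H$, the interval is $\llbracket L, H \rrbracket = \{K \in \mathcal{CD}(G) : L \leq K \leq H\}$. A lattice is a quasi-antichain if it consists of a maximum, a minimum, and the atoms of the lattice (the atoms being distinct from the maximum and minimum, and pairwise incomparable); its width is the number of atoms. *)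

(* Defs.v *)
From mathcomp Require Import all_boot all_fingroup all_solvable.
Set Implicit Arguments.
Unset Strict Implicit.
Unset Printing Implicit Defensive.
Local Open Scope group_scope.

Definition cd_measure (gT : finGroupType) (G U : {group gT}) : nat :=
  (#|U| * #|'C_G(U)|)%N.

Definition cd_max (gT : finGroupType) (G : {group gT}) : nat :=
  \max_(U : {group gT} | U \subset G) cd_measure G U.

Definition cd_lattice (gT : finGroupType) (G : {group gT}) :
    {set {group gT}} :=
  [set U : {group gT} | (U \subset G) && (cd_measure G U == cd_max G)].

Definition cd_interval (gT : finGroupType) (G L H : {group gT}) :
    {set {group gT}} :=
  [set K in cd_lattice G | (L \subset K) && (K \subset H)].

(* In the following definitions the family S is ordered by inclusion. *)

Definition is_minimum (gT : finGroupType) (S : {set {group gT}})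
    (B : {group gT}) : Prop :=
  B \in S /\ (forall K : {group gT}, K \in S -> B \subset K).

Definition is_maximum (gT : finGroupType) (S : {set {group gT}})
    (T : {group gT}) : Prop :=
  T \in S /\ (forall K : {group gT}, K \in S -> K \subset T).

(* Meaningful when B is the minimum of S. *)
Definition atoms (gT : finGroupType) (S : {set {group gT}})
    (B : {group gT}) : {set {group gT}} :=
  [set A in S | (B \proper A) &&
     [forall K in S, ~~ ((B \proper K) && (K \proper A))]].

(* That S is a lattice need not be required: a family consisting of a minimum,
   a maximum and pairwise incomparable elements in between always is one. *)
Definition quasi_antichain (gT : finGroupType) (S : {set {group gT}})
    (w : nat) : Prop :=
  exists B T : {group gT},
    [/\ is_minimum S B,
        is_maximum S T,
        S = [set B; T] :|: atoms S B,
        [/\ B \notin atoms S B, T \notin atoms S B &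
            {in atoms S B &, forall A1 A2 : {group gT},
               A1 \subset A2 -> A1 = A2}] &
        #|atoms S B| = w].

(* Main.v *)
Require Import Defs.
From mathcomp Require Import all_boot all_fingroup all_solvable.
Local Open Scope group_scope.

(** Write M = 'C_G(L) and N = 'C_G(H). Taking centralisers reverses the order
    of the Chermak-Delgado lattice and is an involution there, so every fact
    about the interval from L to H has a twin about the interval from N to M.
    The statement about M / N comes from this duality together with
    #|L| * #|M| = #|H| * #|N|.

    Two distinct intermediate members K1, K2 satisfy K1 * K2 = H and
    K1 :&: K2 = L, and each is normal in H because a Chermak-Delgado subgroup
    permutes with its conjugates. Having three of them makes H / L abelian, for
    K1 / L centralises both K2 / L and K3 / L, which generate H / L. It also
    forces [H, M] <= L (cd_commg_bottom): an element of 'C_G(K) acts trivially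
    on H / K' for every K' other than K. By duality [H, M] <= N too, so [H, M]
    centralises both H and M (cd_commg_central), and the commutator map
    H / L x M / N -> L :&: N is bilinear.

    In these coordinates, fix intermediate members A <> B, so that
    H / L = A / L x B / L. An intermediate K <> B is the graph of a homomorphism
    phi_K from A / L to B / L, injective unless K = A. The graph of phi belongs
    to the lattice exactly when phi has an adjoint for the pairing, and having
    an adjoint is preserved by sums: the sum of the graphs of phi and phi', a
    fibre sum over the A-coordinate, commutes with the fibre sum of the adjoint
    graphs, and the two are large enough to reach the maximal measure
    (cd_between_fibre_sum). Hence the phi_K form an additive group S in which
    every nonzero element is injective, and #|S| = w - 1.

    Everything follows from S. If p divides #|A / L| and phi in S is nonzero,
    then p phi kills an element of order p, so p phi = 0 and B / L, the image
    of phi, has exponent p (cd_between_exponent). Evaluation at a point x of A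
    outside L embeds S in B / L (cd_fibre_group), so w - 1 divides
    #|B / L| = p ^ a, while #|H / L| = #|B / L| ^ 2. *)

(** * Subgroups of maximal Chermak-Delgado measure *)

Section Basics.

Set Implicit Arguments.
Unset Strict Implicit.
Unset Printing Implicit Defensive.

Variables (gT : finGroupType) (G : {group gT}).
Implicit Types U V K L H : {group gT}.

Lemma cd_measure_le_max U : U \subset G -> (cd_measure G U <= cd_max G)%N.
Proof. by move=> sUG; rewrite /cd_max (bigmax_sup U). Qed.

Lemma cd_lattice_sub U : U \in cd_lattice G -> U \subset G.
Proof. by rewrite inE => /andP[]. Qed.

Lemma cd_lattice_measure U :
  U \in cd_lattice G -> (#|U| * #|'C_G(U)|)%N = cd_max G.
Proof. by rewrite inE => /andP[_ /eqP]. Qed.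

Lemma cd_latticeI U :
  U \subset G -> (cd_max G <= cd_measure G U)%N -> U \in cd_lattice G.
Proof. by move=> sUG leU; rewrite inE sUG eqn_leq leU cd_measure_le_max. Qed.

Lemma sub_subcent_subcent U : U \subset G -> U \subset 'C_G('C_G(U)).
Proof. by move=> sUG; rewrite subsetI sUG centsC subsetIr. Qed.

(** The double centraliser contains U, and the measure of 'C_G(U) would exceed
    the maximum if it were larger. *)
Lemma cd_subcentK U : U \in cd_lattice G -> ('C_G('C_G(U)))%G = U.
Proof.
move=> cdU; apply/esym/val_inj/eqP; have sUG := cd_lattice_sub cdU.
rewrite eqEcard sub_subcent_subcent //=.
have := cd_measure_le_max (subsetIl G 'C(U)).
by rewrite -(cd_lattice_measure cdU) /cd_measure mulnC leq_pmul2r ?cardG_gt0.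
Qed.

Lemma cd_subcent U : U \in cd_lattice G -> ('C_G(U))%G \in cd_lattice G.
Proof.
move=> cdU; have /(congr1 val)/= ccU := cd_subcentK cdU.
apply: cd_latticeI; rewrite ?subsetIl // /cd_measure /= ccU mulnC.
by rewrite (cd_lattice_measure cdU).
Qed.

Lemma cd_subcent_neq K1 K2 :
    K1 \in cd_lattice G -> K2 \in cd_lattice G -> K1 != K2 ->
  ('C_G(K1))%G != ('C_G(K2))%G.
Proof.
move=> cdK1 cdK2; apply: contra => /eqP eqC.
have := congr1 (fun K : {group gT} => ('C_G(K))%G) eqC.
by rewrite /= !cd_subcentK // => ->.
Qed.

Lemma squeeze_mul m x y :
    (0 < m)%N -> (m * m = x * y)%N -> (x <= m)%N -> (y <= m)%N ->
  (m <= x)%N /\ (m <= y)%N.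
Proof.
move=> m_gt0 eq_xy le_xm le_ym; split.
  by rewrite -(leq_pmul2r m_gt0) eq_xy leq_mul2l le_ym orbT.
by rewrite -(leq_pmul2l m_gt0) eq_xy leq_mul2r le_xm orbT.
Qed.

(** The measures of the join and the meet multiply to at least the square of the
    maximum, because #|U * V| <= #|U <*> V| and 'C_G(U) * 'C_G(V) lies in
    'C_G(U :&: V). All these inequalities are therefore equalities; the first
    one says that U and V permute. *)
Lemma cd_join_meet U V :
    U \in cd_lattice G -> V \in cd_lattice G ->
  [/\ (U <*> V)%G \in cd_lattice G, (U :&: V)%G \in cd_lattice G
    & U <*> V = U * V].
Proof.
move=> cdU cdV; have [sUG sVG] := (cd_lattice_sub cdU, cd_lattice_sub cdV).
have sJG : U <*> V \subset G by rewrite join_subG sUG.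
have sIG : U :&: V \subset G by rewrite subIset ?sUG.
have sMJ : U * V \subset U <*> V by rewrite mul_subG ?joing_subl ?joing_subr.
have sCI : 'C_G(U) * 'C_G(V) \subset 'C_G(U :&: V).
  by rewrite mul_subG ?setIS ?centS ?subsetIl ?subsetIr.
have leJ := cd_measure_le_max sJG; have leI := cd_measure_le_max sIG.
have eqC : 'C_G(U <*> V) = 'C_G(U) :&: 'C_G(V).
  by rewrite centY setIACA setIid.
move: leJ leI; rewrite /cd_measure /= eqC => leJ leI.
have mU := cd_lattice_measure cdU; have mV := cd_lattice_measure cdV.
have cM := mul_cardG U V; have cC := mul_cardG 'C_G(U) 'C_G(V).
have leMJ := subset_leq_card sMJ; have leCI := subset_leq_card sCI.
have m_gt0 : (0 < cd_max G)%N by rewrite -mU muln_gt0 !cardG_gt0.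
have c_gt0 := cardG_gt0 ('C_G(U) :&: 'C_G(V)).
have prod_m : (cd_max G * cd_max G = (#|(U * V)%g| * #|'C_G(U) :&: 'C_G(V)|) *
    (#|U :&: V| * #|('C_G(U) * 'C_G(V))%g|))%N.
  rewrite -{1}mU -mV mulnACA cM cC mulnACA [RHS]mulnACA.
  by rewrite [(_ * #|('C_G(U) * _)%g|)%N]mulnC -mulnACA.
have leJ1 := leq_mul leMJ (leqnn #|'C_G(U) :&: 'C_G(V)|).
have leI1 := leq_mul (leqnn #|U :&: V|) leCI.
have [geJ geI] := squeeze_mul m_gt0 prod_m
  (leq_trans leJ1 leJ) (leq_trans leI1 leI).
split.
- by apply: cd_latticeI => //; rewrite /cd_measure /= eqC (leq_trans geJ).
- by apply: cd_latticeI => //; rewrite /cd_measure /= (leq_trans geI).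
apply/esym/eqP; rewrite eqEcard sMJ /=.
by rewrite -(leq_pmul2r c_gt0) (leq_trans leJ).
Qed.

Lemma cd_conj U x : x \in G -> U \in cd_lattice G -> (U :^ x)%G \in cd_lattice G.
Proof.
move=> Gx cdU; have sUG := cd_lattice_sub cdU.
have defC : 'C_G(U :^ x) = 'C_G(U) :^ x by rewrite conjIg centJ conjGid.
apply: cd_latticeI; first by rewrite /= -(conjGid Gx) conjSg.
by rewrite /cd_measure /= defC !cardJg cd_lattice_measure.
Qed.

(** K permutes with each of its conjugates under H, so K * K :^ x is a member of
    the lattice between K and H. It is not H, since a group is never the product
    of a proper subgroup and one of its conjugates. *)
Lemma cd_maximal_normal K H :
    K \in cd_lattice G -> H \in cd_lattice G -> K \proper H ->
    (forall X : {group gT}, X \in cd_lattice G -> K \subset X -> X \proper H ->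
       X = K) ->
  K <| H.
Proof.
move=> cdK cdH /properP[sKH [z Hz notKz]] maxK; rewrite /normal sKH.
apply/subsetP=> x Hx; rewrite inE.
have Gx := subsetP (cd_lattice_sub cdH) x Hx.
have [cdJ _ defJ] := cd_join_meet cdK (cd_conj Gx cdK).
have sJH : K <*> K :^ x \subset H by rewrite join_subG sKH -(conjGid Hx) conjSg.
have [prJ | notprJ] := boolP (K <*> K :^ x \proper H).
  by rewrite -{2}(maxK _ cdJ (joing_subl _ _) prJ) joing_subr.
have eqJ : K * K :^ x = H.
  by apply/eqP; rewrite -defJ eqEproper sJH.
have : x \in K * K :^ x by rewrite eqJ.
case/mulsgP=> k _ Kk /imsetP[k' Kk' ->] defx.
(* Cancelling x in x = k * (x^-1 * k' * x) gives x = k' * k. *)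
suffices Kx : x \in K by rewrite conjGid.
have kxk' : k * x^-1 * k' = 1.
  by apply: (mulIg x); rewrite mul1g [RHS]defx conjgE !mulgA.
have -> : x = k' * k; last exact: groupM.
apply: invg_inj; apply: (mulgI k); apply: (mulIg k').
by rewrite kxk' invMg mulKVg mulVg.
Qed.

End Basics.

(** * Intervals whose intermediate members are pairwise incomparable *)

Section Antichain.

Set Implicit Arguments.
Unset Strict Implicit.
Unset Printing Implicit Defensive.

Variables (gT : finGroupType) (G : {group gT}).
Implicit Types A B K L H : {group gT}.

Definition cd_between L H : {set {group gT}} :=
  [set K in cd_lattice G | (L \proper K) && (K \proper H)].

(** The quasi-antichain hypothesis in a form that is visibly self-dual under
    centralisers. *)
Record cd_antichain L H : Prop := CdAntichain {
  cd_bottom : L \in cd_lattice G;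
  cd_top : H \in cd_lattice G;
  cd_bottom_top : L \proper H;
  cd_incomparable : {in cd_between L H &,
    forall K1 K2, K1 \subset K2 -> K1 = K2};
  cd_wide : (2 < #|cd_between L H|)%N
}.

Lemma cd_betweenP L H K :
  reflect [/\ K \in cd_lattice G, L \proper K & K \proper H]
          (K \in cd_between L H).
Proof. by rewrite [K \in cd_between _ _]in_set; apply: and3P. Qed.

Lemma cd_subcent_proper L H :
    L \in cd_lattice G -> H \in cd_lattice G -> L \proper H ->
  'C_G(H) \proper 'C_G(L).
Proof.
move=> cdL cdH /andP[sLH not_sHL]; rewrite /proper setIS ?centS //=.
apply: contra not_sHL => sC.
have /(congr1 val)/= <- := cd_subcentK cdL.
have /(congr1 val)/= <- := cd_subcentK cdH.
by rewrite setIS ?centS.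
Qed.

Lemma cd_between_subcent L H K :
    L \in cd_lattice G -> H \in cd_lattice G -> K \in cd_between L H ->
  ('C_G(K))%G \in cd_between 'C_G(H) 'C_G(L).
Proof.
move=> cdL cdH /cd_betweenP[cdK ltLK ltKH].
by apply/cd_betweenP; rewrite cd_subcent ?cd_subcent_proper.
Qed.

Lemma cd_antichain_subcent L H :
  cd_antichain L H -> cd_antichain 'C_G(H) 'C_G(L).
Proof.
case=> cdL cdH ltLH incLH wideLH; split; rewrite ?cd_subcent //.
- exact: cd_subcent_proper.
- move=> K1 K2 K1in K2in sK12.
  have back K : K \in cd_between 'C_G(H) 'C_G(L) -> ('C_G(K))%G \in cd_between L H.
    move/(cd_between_subcent (cd_subcent cdH) (cd_subcent cdL)).
    by rewrite !cd_subcentK.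
  have cdK1 : K1 \in cd_lattice G by case/cd_betweenP: K1in.
  have cdK2 : K2 \in cd_lattice G by case/cd_betweenP: K2in.
  have eqC : ('C_G(K2))%G = ('C_G(K1))%G.
    by apply: incLH; rewrite ?back //= setIS ?centS.
  have := congr1 (fun K : {group gT} => ('C_G(K))%G) eqC.
  by rewrite /= !cd_subcentK.
have inj : {in cd_between L H &, injective (fun K => ('C_G(K))%G)}.
  move=> K1 K2 /cd_betweenP[cdK1 _ _] /cd_betweenP[cdK2 _ _] eqC.
  have := congr1 (fun K : {group gT} => ('C_G(K))%G) eqC.
  by rewrite /= !cd_subcentK.
apply: leq_trans wideLH _; rewrite -(card_in_imset inj) subset_leq_card //.
by apply/subsetP=> _ /imsetP[K Kin ->]; apply: cd_between_subcent.
Qed.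

(** * The abelian quotient *)

Section Structure.

Variables L H : {group gT}.
Hypothesis acLH : cd_antichain L H.

Let cdL := cd_bottom acLH.
Let cdH := cd_top acLH.

Lemma cd_between_sub K :
  K \in cd_between L H -> [/\ L \subset K, K \subset H & K \subset G].
Proof.
case/cd_betweenP=> cdK ltLK ltKH.
by split; [apply: proper_sub | apply: proper_sub | apply: cd_lattice_sub].
Qed.

Lemma cd_between_mul K1 K2 :
    K1 \in cd_between L H -> K2 \in cd_between L H -> K1 != K2 ->
  K1 * K2 = H.
Proof.
move=> K1in K2in neqK; have [sLK1 sK1H _] := cd_between_sub K1in.
have [_ sK2H _] := cd_between_sub K2in.
have /cd_betweenP[cdK1 ltLK1 _] := K1in; have /cd_betweenP[cdK2 _ _] := K2in.
have [cdJ _ <-] := cd_join_meet cdK1 cdK2.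
have sJH : K1 <*> K2 \subset H by rewrite join_subG sK1H.
apply/eqP; rewrite eqEproper sJH /=; apply: contra neqK => ltJH.
have Jin : (K1 <*> K2)%G \in cd_between L H.
  by apply/cd_betweenP; rewrite cdJ (proper_sub_trans ltLK1) ?joing_subl.
apply/eqP/(etrans (y := (K1 <*> K2)%G)).
  by apply: (cd_incomparable acLH) => //; apply: joing_subl.
by apply/esym/(cd_incomparable acLH) => //; apply: joing_subr.
Qed.

Lemma cd_between_meet K1 K2 :
    K1 \in cd_between L H -> K2 \in cd_between L H -> K1 != K2 ->
  K1 :&: K2 = L.
Proof.
move=> K1in K2in neqK; have [sLK1 sK1H _] := cd_between_sub K1in.
have [sLK2 _ _] := cd_between_sub K2in.
have /cd_betweenP[cdK1 _ ltK1H] := K1in; have /cd_betweenP[cdK2 _ _] := K2in.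
have [_ cdI _] := cd_join_meet cdK1 cdK2.
have sLI : L \subset K1 :&: K2 by rewrite subsetI sLK1.
apply/esym/eqP; rewrite eqEproper sLI /=; apply: contra neqK => ltLI.
have Iin : (K1 :&: K2)%G \in cd_between L H.
  by apply/cd_betweenP; rewrite cdI (sub_proper_trans (subsetIl _ _)).
apply/eqP/(etrans (y := (K1 :&: K2)%G)).
  by apply/esym/(cd_incomparable acLH) => //; apply: subsetIl.
by apply: (cd_incomparable acLH) => //; apply: subsetIr.
Qed.

Lemma cd_between_normal K : K \in cd_between L H -> K <| H.
Proof.
move=> Kin; have /cd_betweenP[cdK ltLK ltKH] := Kin.
apply: (cd_maximal_normal cdK cdH ltKH) => X cdX sKX ltXH.
apply/esym/(cd_incomparable acLH) => //; apply/cd_betweenP.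
by rewrite cdX (proper_sub_trans ltLK).
Qed.

Lemma cd_between_avoid2 A B :
  exists2 K, K \in cd_between L H & (K != A) && (K != B).
Proof.
have : (0 < #|cd_between L H :\: [set A; B]|)%N.
  rewrite cardsD subn_gt0 (leq_ltn_trans _ (cd_wide acLH)) //.
  by rewrite (leq_trans (subset_leq_card (subsetIr _ _))) // cards2 ltnS leq_b1.
case/card_gt0P=> K; rewrite in_setD in_set2 negb_or => /andP[neK Kin].
by exists K.
Qed.

Lemma cd_between_pair : exists K1 K2,
  [/\ K1 \in cd_between L H, K2 \in cd_between L H & K1 != K2].
Proof.
have [K1 K1in _] := cd_between_avoid2 L L.
have [K2 K2in /andP[neK _]] := cd_between_avoid2 K1 K1.
by exists K1, K2; rewrite eq_sym.
Qed.

Lemma cd_bottom_normal : L <| H.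
Proof.
have [K1 [K2 [K1in K2in neK]]] := cd_between_pair.
rewrite -(cd_between_meet K1in K2in neK).
by rewrite normalI ?cd_between_normal.
Qed.

Lemma cd_between_cent_quotient K1 K2 :
    K1 \in cd_between L H -> K2 \in cd_between L H -> K1 != K2 ->
  K2 / L \subset 'C(K1 / L).
Proof.
move=> K1in K2in neK; apply: quotient_cents2r.
have [[_ sK1H _] [_ sK2H _]] := (cd_between_sub K1in, cd_between_sub K2in).
rewrite -(cd_between_meet K1in K2in neK) subsetI.
have nK K' (X : {group gT}) : K' \in cd_between L H -> X \subset H -> X \subset 'N(K').
  by move=> K'in sXH; rewrite (subset_trans sXH) ?normal_norm ?cd_between_normal.
by rewrite commg_subl commg_subr !nK.
Qed.

(** K / L centralises the quotients of two other intermediate members, and these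
    generate H / L; so H / L is generated by central subgroups. *)
Lemma cd_quotient_abelian : abelian (H / L).
Proof.
have nLH := normal_norm cd_bottom_normal.
have cKH K : K \in cd_between L H -> H / L \subset 'C(K / L).
  move=> Kin; have [K1 K1in /andP[neK1 _]] := cd_between_avoid2 K K.
  have [K2 K2in /andP[neK2 neK12]] := cd_between_avoid2 K K1.
  rewrite -(cd_between_mul K1in K2in); last by rewrite eq_sym.
  have [_ sK1H _] := cd_between_sub K1in.
  rewrite quotientMl ?(subset_trans sK1H) // mul_subG //.
    by rewrite cd_between_cent_quotient // eq_sym.
  by rewrite cd_between_cent_quotient // eq_sym.
have [K1 [K2 [K1in K2in neK]]] := cd_between_pair.
have [_ sK1H _] := cd_between_sub K1in.
rewrite /abelian -{1}(cd_between_mul K1in K2in neK).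
by rewrite quotientMl ?(subset_trans sK1H) // mul_subG // centsC cKH.
Qed.

End Structure.


(** * The commutator pairing *)

(** By duality 'C_G(K) is normal in 'C_G(L), and K = 'C_G('C_G(K)). *)
Lemma cd_between_cent_norm L H K :
  cd_antichain L H -> K \in cd_between L H -> 'C_G(L) \subset 'N(K).
Proof.
move=> acLH Kin; have /cd_betweenP[cdK _ _] := Kin.
have CKin := cd_between_subcent (cd_bottom acLH) (cd_top acLH) Kin.
have nCK := normal_norm (cd_between_normal (cd_antichain_subcent acLH) CKin).
have /(congr1 val)/= <- := cd_subcentK cdK.
by rewrite normsI ?norms_cent // normsG ?subsetIl.
Qed.

(** Let y centralise K. For any other K', write h = k * k' with k in K and k' in
    K'; then [~ h, y] = [~ k', y] lies in K', which y normalises. Two different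
    choices of K' put [~ h, y] in their intersection L. Elements y of this kind
    generate 'C_G(L), because dually 'C_G(L) = 'C_G(K1) * 'C_G(K2). *)
Lemma cd_commg_bottom L H h c :
  cd_antichain L H -> h \in H -> c \in 'C_G(L) -> [~ h, c] \in L.
Proof.
move=> acLH Hh.
have comK K y : K \in cd_between L H -> y \in 'C_G(K) -> [~ h, y] \in L.
  move=> Kin cKy; have [sLK _ _] := cd_between_sub Kin.
  have My : y \in 'C_G(L) by apply: subsetP cKy; rewrite setIS ?centS.
  have comK' K' : K' \in cd_between L H -> K' != K -> [~ h, y] \in K'.
    move=> K'in neK; have := Hh.
    rewrite -(cd_between_mul acLH Kin K'in) 1?eq_sym // => /mulsgP[k k' Kk Kk' ->].
    have /commgP/eqP ky1 : commute k y.
      by case/setIP: cKy => _ /centP cKy; apply/esym/cKy.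
    rewrite commMgJ ky1 conj1g mul1g commgEl groupM ?groupV //.
    by rewrite memJ_norm // (subsetP (cd_between_cent_norm acLH K'in)).
  have [K1 K1in /andP[neK1 _]] := cd_between_avoid2 acLH K K.
  have [K2 K2in /andP[neK2 neK12]] := cd_between_avoid2 acLH K K1.
  by rewrite -(cd_between_meet acLH K2in K1in neK12) inE !comK'.
have [K1 [K2 [K1in K2in neK]]] := cd_between_pair acLH.
have inD := cd_between_subcent (cd_bottom acLH) (cd_top acLH).
have /cd_betweenP[cdK1 _ _] := K1in; have /cd_betweenP[cdK2 _ _] := K2in.
have neC := cd_subcent_neq cdK1 cdK2 neK.
have acD := cd_antichain_subcent acLH.
rewrite -(cd_between_mul acD (inD _ K1in) (inD _ K2in) neC).
case/mulsgP=> c1 c2 cK1 cK2 ->.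
have Lhc1 := comK _ _ K1in cK1; have Lhc2 := comK _ _ K2in cK2.
have [sLK2 _ _] := cd_between_sub K2in.
rewrite commgMJ groupM // (_ : _ ^ c2 = [~ h, c1]) //.
apply/conjg_fixP/commgP/esym.
by case/setIP: cK2 => _ /centP; apply; apply: (subsetP sLK2).
Qed.

(** The commutator lies in L, which 'C_G(L) centralises, and by duality in
    'C_G(H). *)
Lemma cd_commg_central L H h c x :
    cd_antichain L H -> h \in H -> c \in 'C_G(L) -> (x \in H) || (x \in 'C_G(L)) ->
  [~ h, c] ^ x = [~ h, c].
Proof.
move=> acLH Hh Mc xHM; apply/conjg_fixP/commgP.
have [Mx | notMx] := boolP (x \in 'C_G(L)).
  have /setIP[_ /centP cLx] := Mx.
  by apply/esym/cLx; apply: cd_commg_bottom Hh Mc.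
have Hx : x \in H by rewrite (negPf notMx) orbF in xHM.
have Hh' : h \in 'C_G('C_G(H)%G).
  by have /(congr1 val)/= -> := cd_subcentK (cd_top acLH).
have := cd_commg_bottom (cd_antichain_subcent acLH) Mc Hh'.
by rewrite -groupV invg_comm => /setIP[_ /centP]; apply.
Qed.

Section Pairing.

Variables L H : {group gT}.
Hypothesis acLH : cd_antichain L H.

Lemma cd_commgMl h h' c :
    h \in H -> h' \in H -> c \in 'C_G(L) ->
  [~ h * h', c] = [~ h, c] * [~ h', c].
Proof. by move=> Hh Hh' Mc; rewrite commMgJ (cd_commg_central acLH) ?Hh'. Qed.

Lemma cd_commgMr h c c' :
    h \in H -> c \in 'C_G(L) -> c' \in 'C_G(L) ->
  [~ h, c * c'] = [~ h, c'] * [~ h, c].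
Proof. by move=> Hh Mc Mc'; rewrite commgMJ (cd_commg_central acLH) ?Mc' ?orbT. Qed.

End Pairing.

(** * Sums of graphs *)

(** In the abelian quotient, let K and K' be the graphs of homomorphisms
    phi and phi' from A to B (written multiplicatively). Then this is the graph
    of phi + phi'. *)
Definition fibre_sum (A B K K' : {set gT}) : {set gT} :=
  [set t.1.1 * t.1.2 * t.2 | t in [set t : gT * gT * gT |
     [&& t.1.1 \in A, t.1.2 \in B, t.2 \in B, t.1.1 * t.1.2 \in K
       & t.1.1 * t.2 \in K']]].

Lemma fibre_sumP (A B K K' : {set gT}) x :
  reflect (exists a b b', [/\ a \in A, b \in B & b' \in B] /\
             [/\ a * b \in K, a * b' \in K' & x = a * b * b'])
          (x \in fibre_sum A B K K').
Proof.
apply: (iffP imsetP) => [[[[a b] b']]|[a [b [b' [[Aa Bb Bb'] [Kab Kab' ->]]]]]].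
  by rewrite inE /= => /and5P[Aa Bb Bb' Kab Kab'] ->; exists a, b, b'.
by exists (a, b, b'); rewrite // inE /= Aa Bb Bb' Kab.
Qed.

Lemma fibre_sum_sub (A B K K' H : {group gT}) :
  A \subset H -> B \subset H -> fibre_sum A B K K' \subset H.
Proof.
move=> sAH sBH; apply/subsetP=> _ /fibre_sumP[a [b [b' [[Aa Bb Bb'] [_ _ ->]]]]].
by rewrite !groupM ?(subsetP sAH a) ?(subsetP sBH b) ?(subsetP sBH b').
Qed.

Lemma bottom_sub_fibre_sum L H A (B : {group gT}) K K' :
    A \in cd_between L H -> K \in cd_between L H -> K' \in cd_between L H ->
  L \subset fibre_sum A B K K'.
Proof.
move=> /cd_between_sub[sLA _ _] /cd_between_sub[sLK _ _].
case/cd_between_sub=> sLK' _ _; apply/subsetP=> l Ll.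
apply/fibre_sumP; exists l, 1, 1.
by rewrite !mulg1 !group1 (subsetP sLA) ?(subsetP sLK) ?(subsetP sLK').
Qed.

(** K is a graph over A, read along B: any h can be moved into K by a factor
    from B. *)
Lemma cd_between_lift L H K B h :
    cd_antichain L H -> K \in cd_between L H -> B \in cd_between L H ->
    K != B -> h \in H ->
  exists2 b, b \in B & h * b \in K.
Proof.
move=> acLH Kin Bin neK.
rewrite -(cd_between_mul acLH Kin Bin neK) => /mulsgP[k b Kk Bb ->].
by exists b^-1; rewrite ?groupV ?mulgK.
Qed.

(** The fibre sum has a point over every element of A, hence together with B it
    covers H = A * B; and it meets B at least in L = A :&: B. *)
Lemma card_fibre_sum L H A B K K' :
    cd_antichain L H ->
    A \in cd_between L H -> B \in cd_between L H ->
    K \in cd_between L H -> K' \in cd_between L H ->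
    A != B -> K != B -> K' != B ->
  (#|A| <= #|<<fibre_sum A B K K'>>|)%N.
Proof.
move=> acLH Ain Bin Kin K'in neA neK neK'.
have [[_ sAH _] [sLB _ _]] := (cd_between_sub Ain, cd_between_sub Bin).
set U := <<_>>.
have sLU : L \subset U.
  by rewrite sub_gen ?(bottom_sub_fibre_sum B Ain Kin K'in).
have sHUB : H \subset U * B.
  apply/subsetP=> h; rewrite -(cd_between_mul acLH Ain Bin neA).
  case/mulsgP=> a b0 Aa Bb0 ->.
  have Ha := subsetP sAH a Aa.
  have [b Bb Kab] := cd_between_lift acLH Kin Bin neK Ha.
  have [b' Bb' Kab'] := cd_between_lift acLH K'in Bin neK' Ha.
  have -> : a * b0 = (a * b * b') * (b'^-1 * b^-1 * b0).
    by rewrite !mulgA !mulgK.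
  have Uabb' : a * b * b' \in U.
    by rewrite mem_gen //; apply/fibre_sumP; exists a, b, b'.
  by rewrite mem_mulg // !groupM ?groupV.
rewrite -(leq_pmul2r (cardG_gt0 B)) !mul_cardG.
rewrite (cd_between_mul acLH Ain Bin neA) (cd_between_meet acLH Ain Bin neA).
by rewrite leq_mul // subset_leq_card // subsetI sLU.
Qed.

(** Let a, b, b' and d, c, c' be the coordinates of the two points. Since A, B,
    K and K' commute with their own centralisers, bilinearity leaves only
    [a,c'] [a,c] [b,d] [b',d], where [a * b, d * c] = 1 says [a,c] [b,d] = 1 and
    [a * b', d * c'] = 1 says [a,c'] [b',d] = 1. *)
Lemma fibre_sum_cent L H A B K K' :
    cd_antichain L H ->
    A \in cd_between L H -> B \in cd_between L H ->
    K \in cd_between L H -> K' \in cd_between L H ->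
  fibre_sum 'C_G(A) 'C_G(B) 'C_G(K) 'C_G(K') \subset 'C(fibre_sum A B K K').
Proof.
move=> acLH Ain Bin Kin K'in.
have [[sLA sAH _] [sLB sBH _]] := (cd_between_sub Ain, cd_between_sub Bin).
apply/subsetP=> _ /fibre_sumP[d [c [c' [[Cd Cc Cc'] [Kdc Kdc' ->]]]]].
apply/centP=> _ /fibre_sumP[a [b [b' [[Aa Bb Bb'] [Kab Kab' ->]]]]].
have com1 (X : {group gT}) x y : x \in X -> y \in 'C_G(X) -> [~ x, y] = 1.
  by move=> Xx /setIP[_ /centP cXy]; apply/eqP/commgP/esym/cXy.
have Ma y : y \in 'C_G(A) -> y \in 'C_G(L) by apply/subsetP; rewrite setIS ?centS.
have Mb y : y \in 'C_G(B) -> y \in 'C_G(L) by apply/subsetP; rewrite setIS ?centS.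
have [Md Mc Mc'] := And3 (Ma d Cd) (Mb c Cc) (Mb c' Cc').
have Ha := subsetP sAH a Aa.
have [Hb Hb'] := (subsetP sBH b Bb, subsetP sBH b' Bb').
apply/esym/commgP/eqP.
have eq1 := com1 _ _ _ Kab Kdc; have eq2 := com1 _ _ _ Kab' Kdc'.
rewrite (cd_commgMl acLH) ?groupM // !(cd_commgMr acLH) ?groupM // in eq2.
rewrite (com1 _ _ _ Aa Cd) (com1 _ _ _ Bb' Cc') mulg1 mul1g in eq2.
rewrite (cd_commgMl acLH) ?groupM // ![[~ _, _ * c']](cd_commgMr acLH) ?groupM //.
rewrite eq1 mulg1 (cd_commgMl acLH) // (com1 _ _ _ Bb Cc') mulg1.
rewrite (com1 _ _ _ Bb' Cc') mul1g (cd_commgMr acLH) //.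
by rewrite (com1 _ _ _ Bb' Cc) mul1g.
Qed.

Lemma cd_between_card K1 K2 L H :
    cd_antichain L H -> K1 \in cd_between L H -> K2 \in cd_between L H ->
  #|K1| = #|K2|.
Proof.
move=> acLH K1in K2in.
have [K Kin /andP[neK1 neK2]] := cd_between_avoid2 acLH K1 K2.
apply/eqP; rewrite -(eqn_pmul2l (cardG_gt0 K)) !mul_cardG.
by rewrite !(cd_between_mul acLH) ?(cd_between_meet acLH).
Qed.

(** The group U generated by the fibre sum is at least as large as A, and its
    centraliser at least as large as 'C_G(A), because the latter contains the
    fibre sum of the centralisers. As A has maximal measure, so has U, and
    #|U| = #|A|. It differs from B because it contains an element of x * B for
    x in A outside L. *)
Lemma cd_between_fibre_sum L H A B K K' :
    cd_antichain L H ->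
    A \in cd_between L H -> B \in cd_between L H ->
    K \in cd_between L H -> K' \in cd_between L H ->
    A != B -> K != B -> K' != B ->
  exists2 U, U \in cd_between L H & U != B /\ fibre_sum A B K K' \subset U.
Proof.
move=> acLH Ain Bin Kin K'in neA neK neK'.
have [[_ sAH _] [sLB sBH _]] := (cd_between_sub Ain, cd_between_sub Bin).
have /cd_betweenP[cdA ltLA ltAH] := Ain; have /cd_betweenP[cdB _ _] := Bin.
have /cd_betweenP[cdK _ _] := Kin; have /cd_betweenP[cdK' _ _] := K'in.
have inD := cd_between_subcent (cd_bottom acLH) (cd_top acLH).
pose U := <<fibre_sum A B K K'>>%G.
have sUH : U \subset H by rewrite gen_subG fibre_sum_sub.
have sUG : U \subset G := subset_trans sUH (cd_lattice_sub (cd_top acLH)).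
have leAU : (#|A| <= #|U|)%N by apply: (card_fibre_sum acLH).
have leCU : (#|'C_G(A)| <= #|'C_G(U)|)%N.
  have acD := cd_antichain_subcent acLH.
  apply: leq_trans (card_fibre_sum acD
    (inD _ Ain) (inD _ Bin) (inD _ Kin) (inD _ K'in)
    (cd_subcent_neq cdA cdB neA) (cd_subcent_neq cdK cdB neK)
    (cd_subcent_neq cdK' cdB neK')) _.
  rewrite subset_leq_card // gen_subG subsetI /U /= cent_gen.
  rewrite (fibre_sum_cent acLH) // andbT.
  by rewrite fibre_sum_sub ?subsetIl.
have mA := cd_lattice_measure cdA.
have cdU : U \in cd_lattice G.
  by apply: cd_latticeI; rewrite // -mA leq_mul.
have eqAU : #|U| = #|A|.
  apply/eqP; rewrite eqn_leq leAU andbT.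
  rewrite -(leq_pmul2r (cardG_gt0 'C_G(A))) mA -(cd_lattice_measure cdU).
  by rewrite leq_mul2l leCU orbT.
have sLU : L \subset U by rewrite sub_gen ?(bottom_sub_fibre_sum B Ain Kin K'in).
exists U; first apply/cd_betweenP.
  by rewrite cdU !properEcard sLU sUH eqAU !proper_card.
split; last exact: subset_gen.
apply/eqP=> eqUB; have /properP[_ [a Aa notLa]] := ltLA.
have Ha := subsetP sAH a Aa.
have [b Bb Kab] := cd_between_lift acLH Kin Bin neK Ha.
have [b' Bb' Kab'] := cd_between_lift acLH K'in Bin neK' Ha.
have : a * b * b' \in U.
  by rewrite mem_gen //; apply/fibre_sumP; exists a, b, b'.
rewrite eqUB !groupMr // => Ba; case/negP: notLa.
by rewrite -(cd_between_meet acLH Ain Bin neA) inE Aa.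
Qed.


(** * Exponent and order of the quotient *)

(** U is the graph of n phi, where K is the graph of phi. *)
Lemma cd_between_multiple L H A B K n :
    cd_antichain L H ->
    A \in cd_between L H -> B \in cd_between L H -> K \in cd_between L H ->
    A != B -> K != B ->
  exists2 U, U \in cd_between L H &
    forall a b, a \in A -> b \in B -> a * b \in K -> a * b ^+ n \in U.
Proof.
move=> acLH Ain Bin Kin neA neK.
suffices [U Uin [_ sumU]] : exists2 U, U \in cd_between L H & U != B /\
    forall a b, a \in A -> b \in B -> a * b \in K -> a * b ^+ n \in U.
  by exists U.
elim: n => [|n [V Vin [neV sumV]]].
  by exists A => //; split=> // a b Aa _ _; rewrite mulg1.
have [U Uin [neU sVKU]] := cd_between_fibre_sum acLH Ain Bin Vin Kin neA neV neK.
exists U => //; split=> // a b Aa Bb Kab; apply: (subsetP sVKU).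
apply/fibre_sumP; exists a, (b ^+ n), b.
by rewrite Aa Bb groupX // sumV // Kab expgSr mulgA.
Qed.

Lemma cd_index_sqr L H K :
    cd_antichain L H -> K \in cd_between L H ->
  #|H : L| = (#|K : L| * #|K : L|)%N.
Proof.
move=> acLH Kin; have [K' K'in /andP[neK' _]] := cd_between_avoid2 acLH K K.
have [sLK sKH _] := cd_between_sub Kin.
have neK : K != K' by rewrite eq_sym.
have cardKK : (#|K| * #|K| = #|H| * #|L|)%N.
  rewrite {2}(cd_between_card acLH Kin K'in) mul_cardG.
  by rewrite (cd_between_mul acLH Kin K'in neK) (cd_between_meet acLH Kin K'in neK).
have L2_gt0 : (0 < #|L| * #|L|)%N by rewrite muln_gt0 !cardG_gt0.
apply/eqP; rewrite -(eqn_pmul2l L2_gt0) [X in _ == X]mulnACA !Lagrange //.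
by rewrite -mulnA Lagrange ?(subset_trans sLK) // cardKK mulnC.
Qed.

(** Choose A and K so that A, B, K are distinct, with K the graph of phi, and x
    in A of order p modulo L. Then p phi vanishes at x, so the graph U of p phi
    meets A outside L, which forces U = A, that is p phi = 0. As phi is onto
    B / L, the exponent of B / L divides p. *)
Lemma cd_between_exponent L H B p b :
    cd_antichain L H -> B \in cd_between L H -> prime p -> p %| #|H : L| ->
  b \in B -> b ^+ p \in L.
Proof.
move=> acLH Bin pr_p dvd_p Bb.
have [A Ain /andP[neA _]] := cd_between_avoid2 acLH B B.
have [K Kin /andP[neKA neKB]] := cd_between_avoid2 acLH A B.
have [[sLA sAH _] [sLB sBH _]] := (cd_between_sub Ain, cd_between_sub Bin).
have [sLK sKH _] := cd_between_sub Kin.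
have nLH := normal_norm (cd_bottom_normal acLH).
have nLA := subset_trans sAH nLH.
have [|xL] := Cauchy pr_p (_ : p %| #|A / L|).
  move: dvd_p; rewrite card_quotient // (cd_index_sqr acLH Ain).
  by rewrite Euclid_dvdM // orbb.
case/morphimP=> x nLx Ax -> ord_x.
have Hx := subsetP sAH x Ax.
have Lxp : x ^+ p \in L.
  by apply: coset_idr; rewrite ?groupX // morphX // -ord_x expg_order.
have notLx : x \notin L.
  apply: contraL (prime_gt1 pr_p) => Lx.
  by rewrite -ord_x /= coset_id // order1.
have [U Uin pU] := cd_between_multiple p acLH Ain Bin Kin neA neKB.
have [sLU _ _] := cd_between_sub Uin.
(* U and A share x: x * c lies in K with c in B, and c ^+ p is in L. *)
have defU : U = A.
  have [c Bc Kxc] := cd_between_lift acLH Kin Bin neKB Hx.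
  have Hc := subsetP sBH c Bc; have nLc := subsetP nLH c Hc.
  have Lcp : c ^+ p \in L.
    rewrite -(cd_between_meet acLH Kin Bin neKB) inE [_ \in B]groupX // andbT.
    have eq_coset : coset L (c ^+ p) = coset L ((x * c) ^+ p).
      rewrite !morphX ?groupM // morphM // expgMn.
        by rewrite -[X in _ = X * _]morphX // [X in _ = X * _]coset_id // mul1g.
      by apply: (centsP (cd_quotient_abelian acLH)); apply: mem_quotient.
    have [||l Ll ->] := kercoset_rcoset _ _ eq_coset.
    - exact: groupX.
    - by rewrite groupX ?groupM.
    by rewrite groupM ?groupX // (subsetP sLK).
  apply/eqP/negPn/negP=> neU; case/negP: notLx.
  rewrite -(cd_between_meet acLH Uin Ain neU) inE Ax andbT.
  by rewrite -(groupMr _ (subsetP sLU _ Lcp)) pU.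
(* Every b in B is a value of phi, since H = K * A as well. *)
have [a Aa Kba] := cd_between_lift acLH Kin Ain neKA (subsetP sBH b Bb).
have Kab : a * b \in K.
  have -> : a * b = (b * a) ^ b by rewrite conjgE !mulgA mulVg mul1g.
  rewrite memJ_norm // (subsetP (normal_norm (cd_between_normal acLH Kin))) //.
  exact: (subsetP sBH).
have := pU a b Aa Bb Kab; rewrite defU groupMl // => Abp.
by rewrite -(cd_between_meet acLH Ain Bin neA) inE Abp groupX.
Qed.

Lemma cd_quotient_abelem L H p :
    cd_antichain L H -> prime p -> p %| #|H : L| -> p.-abelem (H / L).
Proof.
move=> acLH pr_p dvd_p; have abV := cd_quotient_abelian acLH.
have nLH := normal_norm (cd_bottom_normal acLH).
apply/(abelemP pr_p); split=> // _ /morphimP[h nLh Hh ->].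
have [K1 [K2 [K1in K2in neK]]] := cd_between_pair acLH.
have [[_ sK1H _] [_ sK2H _]] := (cd_between_sub K1in, cd_between_sub K2in).
move: Hh; rewrite -(cd_between_mul acLH K1in K2in neK) => /mulsgP[x y Kx Ky ->].
have [Hx Hy] := (subsetP sK1H x Kx, subsetP sK2H y Ky).
have [nLx nLy] := (subsetP nLH x Hx, subsetP nLH y Hy).
rewrite morphM // expgMn; last by apply: (centsP abV); apply: mem_quotient.
rewrite -!morphX //= !coset_id ?mulg1 //.
  exact: cd_between_exponent K2in pr_p dvd_p Ky.
exact: cd_between_exponent K1in pr_p dvd_p Kx.
Qed.

(** T collects the values at x of the homomorphisms whose graphs are the
    intermediate members other than B, where x is a fixed element of A outside
    L. Fibre sums make T a group. Distinct graphs take values in distinct cosets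
    of L, as two intermediate members meet only in L, and A is the graph of the
    zero homomorphism. *)
Lemma cd_fibre_group L H B :
    cd_antichain L H -> B \in cd_between L H ->
  exists2 T : {group gT}, T \subset B & #|T| = (#|cd_between L H|.-1 * #|L|)%N.
Proof.
move=> acLH Bin.
have [A Ain /andP[neA _]] := cd_between_avoid2 acLH B B.
have [[_ sAH _] [sLB sBH _]] := (cd_between_sub Ain, cd_between_sub Bin).
have /cd_betweenP[_ /properP[_ [x Ax notLx]] _] := Ain.
have Hx := subsetP sAH x Ax.
have notBx : x \notin B.
  by apply: contra notLx => Bx; rewrite -(cd_between_meet acLH Ain Bin neA) inE Ax.
pose F (K : {group gT}) :=
  [set b in B | (K \in cd_between L H :\ B) && (x * b \in K)].
pose T := \bigcup_K F K.
have TP b :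
    reflect (exists K, [/\ K \in cd_between L H, K != B, b \in B & x * b \in K])
            (b \in T).
  apply: (iffP bigcupP) => [[K _]|[K [Kin neK Bb Kxb]]].
    by rewrite in_set in_setD1 => /and3P[Bb /andP[neK Kin] Kxb]; exists K.
  by exists K; rewrite // in_set Bb in_setD1 neK Kin.
have groupT : group_set T.
  apply/group_setP; split; first by apply/TP; exists A; rewrite mulg1.
  move=> b b' /TP[K [Kin neK Bb Kxb]] /TP[K' [K'in neK' Bb' Kxb']].
  have [U Uin [neU sU]] := cd_between_fibre_sum acLH Ain Bin Kin K'in neA neK neK'.
  apply/TP; exists U; rewrite groupM // mulgA; split=> //.
  by apply: (subsetP sU); apply/fibre_sumP; exists x, b, b'.
exists (Group groupT); first by apply/subsetP=> b /TP[K []].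
have cardF K : K \in cd_between L H :\ B -> #|F K| = #|L|.
  move=> KinD; have := KinD; rewrite in_setD1 => /andP[neK Kin].
  have [c Bc Kxc] := cd_between_lift acLH Kin Bin neK Hx.
  (* The fibre of K over x is the coset of K :&: B = L through c. *)
  rewrite -(card_lcoset L c); congr #|pred_of_set _|; apply/setP=> b.
  rewrite mem_lcoset -[in RHS](cd_between_meet acLH Kin Bin neK) [LHS]in_set.
  rewrite KinD in_setI /= andbC; congr (_ && _); last by rewrite groupMl ?groupV.
  by rewrite -[RHS](groupMl _ Kxc) mulgA mulgK.
have disjF K K' : K != K' -> [disjoint F K & F K'].
  move=> neKK'; rewrite -setI_eq0; apply/eqP/setP=> b.
  rewrite in_setI [b \in F K]in_set [b \in F K']in_set in_set0 !in_setD1.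
  apply/negP; case/andP=> /and3P[Bb /andP[_ Kin] Kxb] /and3P[_ /andP[_ K'in] K'xb].
  case/negP: notBx; rewrite -(groupMr _ Bb) (subsetP sLB) //.
  by rewrite -(cd_between_meet acLH Kin K'in neKK') inE Kxb.
rewrite /= -sum1_card (partition_disjoint_bigcup _ _ disjF).
rewrite (bigID (mem (cd_between L H :\ B))) /= [X in (_ + X)%N]big1 => [|K notK].
  under eq_bigr => K Kin do rewrite sum1_card cardF //.
  by rewrite addn0 sum_nat_const (cardsD1 B (cd_between L H)) Bin.
rewrite sum1_card; apply/eqP; rewrite cards_eq0; apply/eqP/setP=> b.
by rewrite in_set (negPf notK) andbF in_set0.
Qed.

(** * Quasi-antichain intervals *)

Lemma quasi_antichain_between L H w :
    L \in cd_lattice G -> H \in cd_lattice G -> L \proper H ->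
    quasi_antichain (cd_interval G L H) w -> (3 <= w)%N ->
  cd_antichain L H /\ #|cd_between L H| = w.
Proof.
move=> cdL cdH ltLH [B [T [[Bin minB] [Tin maxT] defS [_ notT inc] cardS]]] w_ge3.
have sLH := proper_sub ltLH.
have inS K : (K \in cd_interval G L H) =
    [&& K \in cd_lattice G, L \subset K & K \subset H] by rewrite [LHS]in_set.
have Lin : L \in cd_interval G L H by rewrite inS cdL subxx.
have Hin : H \in cd_interval G L H by rewrite inS cdH subxx andbT.
have defB : B = L.
  apply/val_inj/eqP; rewrite eqEsubset minB //=.
  by have := Bin; rewrite inS => /and3P[].
have defT : T = H.
  apply/val_inj/eqP; rewrite eqEsubset maxT //= andbT.
  by have := Tin; rewrite inS => /and3P[].
rewrite {}defB {}defT {B T Bin minB Tin maxT} in defS notT inc cardS *.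
suffices eqS : cd_between L H = atoms (cd_interval G L H) L.
  by rewrite -eqS in inc cardS; split=> //; split; rewrite ?cardS.
apply/setP=> K; apply/cd_betweenP/idP => [[cdK ltLK ltKH]|Kin].
  have : K \in [set L; H] :|: atoms (cd_interval G L H) L.
    by rewrite -defS inS cdK !proper_sub.
  rewrite in_setU in_set2 => /orP[|//].
  case/orP=> /eqP eqK; first by rewrite eqK properxx in ltLK.
  by rewrite eqK properxx in ltKH.
have : K \in [set L; H] :|: atoms (cd_interval G L H) L by rewrite in_setU Kin orbT.
rewrite -defS inS => /and3P[cdK _ sKH].
have ltLK : L \proper K by move: Kin; rewrite [K \in _]in_set => /and3P[].
split=> //; rewrite properEneq sKH andbT; apply: contra notT => /eqP eqKH.
have eqKH' : K = H by apply: val_inj.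
by rewrite eqKH' in Kin.
Qed.

End Antichain.

Theorem theorem4 (gT : finGroupType) (G L H : {group gT}) (w : nat)
    (hL : L \in cd_lattice G) (hH : H \in cd_lattice G)
    (hLH : L \proper H)
    (hq : quasi_antichain (cd_interval G L H) w) (hw : (3 <= w)%N) :
  exists p a b : nat,
    [/\ prime p, (0 < a)%N, (0 < b)%N & (b <= a)%N] /\
    [/\ L <| H, p.-abelem (H / L) & #|H / L| = (p ^ (2 * a))%N] /\
    [/\ 'C_G(H) <| 'C_G(L), p.-abelem ('C_G(L) / 'C_G(H)) &
        #|'C_G(L) / 'C_G(H)| = (p ^ (2 * a))%N] /\
    w = (p ^ b + 1)%N.
Proof.
have [acLH cardw] := quasi_antichain_between hL hH hLH hq hw.
have acD := cd_antichain_subcent acLH.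
have [nLH nNM] := (cd_bottom_normal acLH, cd_bottom_normal acD).
(* This is #|L| * #|'C_G(L)| = #|H| * #|'C_G(H)|. *)
have eqIndex : #|'C_G(L) : 'C_G(H)| = #|H : L|.
  have pos : (0 < #|L| * #|'C_G(H)|)%N by rewrite muln_gt0 !cardG_gt0.
  apply/eqP; rewrite -(eqn_pmul2l pos) -mulnA Lagrange ?(normal_sub nNM) //.
  rewrite mulnAC Lagrange ?(normal_sub nLH) //.
  by rewrite (cd_lattice_measure hL) (cd_lattice_measure hH).
have [B Bin _] := cd_between_avoid2 acLH L L.
have /cd_betweenP[_ ltLB _] := Bin; have [sLB _ _] := cd_between_sub Bin.
have indexHL := cd_index_sqr acLH Bin.
have B_gt1 : (1 < #|B : L|)%N by rewrite indexg_gt1 proper_subn.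
pose p := pdiv #|B : L|; have pr_p : prime p by rewrite pdiv_prime.
have dvd_p : p %| #|H : L| by rewrite indexHL dvdn_mull ?pdiv_dvd.
have abV := cd_quotient_abelem acLH pr_p dvd_p.
have abW : p.-abelem ('C_G(L) / 'C_G(H)).
  by apply: (cd_quotient_abelem acD pr_p); rewrite /= eqIndex.
have [|a defa] := @p_natP p #|B : L|.
  apply: pnat_dvd (abelem_pgroup abV).
  by rewrite card_quotient ?normal_norm // indexHL dvdn_mull.
have [T sTB cardT] := cd_fibre_group acLH Bin; rewrite cardw in cardT.
have : w.-1 %| p ^ a.
  rewrite -defa -(dvdn_pmul2r (cardG_gt0 L)) -cardT mulnC Lagrange //.
  exact: cardSg.
case/(dvdn_pfactor _ _ pr_p)=> b le_ba defw.
have card_pa (X Y : {group gT}) :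
    X <| Y -> #|Y : X| = #|H : L| -> #|Y / X| = (p ^ (2 * a))%N.
  move=> nXY; rewrite card_quotient ?normal_norm // => ->.
  by rewrite indexHL defa -expnD addnn mul2n.
have w_gt0 : (0 < w)%N := leq_trans (isT : (0 < 3)%N) hw.
have a_gt0 : (0 < a)%N.
  by rewrite lt0n; apply: contraTneq B_gt1 => a0; rewrite defa a0.
have b_gt0 : (0 < b)%N.
  by rewrite lt0n; apply: contraTneq hw => b0; rewrite -(prednK w_gt0) defw b0.
have defw1 : w = (p ^ b + 1)%N by rewrite -defw addn1 prednK.
by exists p, a, b; rewrite !card_pa.
Qed.
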